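(* Let $G$ be a finitely generated group and let $\varphi:G\times X\to X$ be a continuous action on a compact metric space $(X,d)$. Then $\overline{\mathcal{M}_{PSh}(X,\varphi)}=\mathcal{M}_{PSh}(X,\varphi)$ if and only if $\overline{PSh(\varphi)}=PSh(\varphi)$.
   Context: Fix a finite generating set $S$ of $G$ (discrete topology). For continuous actions $\varphi,\psi$ of $G$ on $X$ put $d_S(\varphi,\psi)=\sup\{d(\varphi(s,x),\psi(s,x)): x\in X, s\in S\}$. A map $f:G\to X$ is a $\delta$-pseudo orbit for $\psi$ if $d(f(sg),\psi(s,f(g)))<\delta$ for all $s\in S$, $g\in G$; it is $(\psi,\epsilon)$-shadowed by $p\in X$ if $d(f(g),\psi(g,p))<\epsilon$ for all $g\in G$. $Sh_\psi(\delta,\epsilon)$ is the set of $x\in X$ such that every $\delta$-pseudo orbit $f$ for $\psi$ with $f(e)=x$ is $(\psi,\epsilon)$-shadowed by a point of $X$. $PSh(\varphi)$ is the set of persistent shadowable points: $x\in X$ such that for every $\epsilon>0$ there is $\delta>0$ such that for every continuous action $\psi:G\times X\to X$ with $d_S(\varphi,\psi)<\delta$, every $\delta$-pseudo orbit $f$ for $\psi$ with $f(e)=x$ is $(\psi,\epsilon)$-shadowed by a point of $X$. $\mathcal{M}(X)$ is the set of Borel probability measures on $X$ with the weak$^*$ topology, and closures of subsets of $\mathcal{M}(X)$ are taken in it. $\mathcal{M}_{PSh}(X,\varphi)$ is the set of $\mu\in\mathcal{M}(X)$ such that for every $\epsilon>0$ there is $\delta>0$ such that for every Borel set $A\subseteq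 X$ with $\mu(A)>0$ one has $A\cap Sh_\psi(\delta,\epsilon)\neq\emptyset$ for every continuous action $\psi:G\times X\to X$ with $d_S(\varphi,\psi)<\delta$. *)

(* Defs.v *)
From HB Require Import structures.
From mathcomp Require Import all_boot all_order all_algebra.
From mathcomp Require Import all_classical all_reals all_analysis.

Set Implicit Arguments.
Unset Strict Implicit.
Unset Printing Implicit Defensive.

Import Order.TTheory GRing.Theory Num.Theory.
Import numFieldNormedType.Exports.

Local Open Scope classical_set_scope.
Local Open Scope ring_scope.

(* Measurable types are pointed in MathComp-Analysis, so Borel measures on a
   metric space require a base point; the point is otherwise unused. *)
#[short(type="pmetricType")]
HB.structure Definition PointedMetric (R : numDomainType) :=
  {X of Pointed X & Metric R X}.

Definition generates (G : groupType) (S : set G) : Prop :=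
  smallest (fun H : set G => group_closed [in H]) S = [set: G].

Record continuous_action (G : groupType) (X : topologicalType) := ContinuousAction {
  act :> G -> X -> X;
  act1 : forall x, act 1%g x = x;
  actM : forall g h x, act (g * h)%g x = act g (act h x);
  act_continuous :
    continuous (fun p : discrete_topology G * X => act p.1 p.2) }.

Section Shadowing.
Context (R : realType) (G : groupType) (X : metricType R).
Implicit Types (S : set G) (phi psi : continuous_action G X) (f : G -> X).

(* On a compact space the set of values is bounded, so [sup] is the genuine
   least upper bound; [sup set0 = 0] covers the case of an empty S. *)
Definition action_dist S phi psi : R :=
  sup [set mdist (phi p.1 p.2) (psi p.1 p.2) | p in S `*` [set: X]].

Definition pseudo_orbit S psi (delta : R) f : Prop :=
  forall s g, S s -> mdist (f (s * g)%g) (psi s (f g)) < delta.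

Definition shadowed_by psi (eps : R) f (p : X) : Prop :=
  forall g, mdist (f g) (psi g p) < eps.

Definition Sh S psi (delta eps : R) : set X :=
  [set x | forall f, pseudo_orbit S psi delta f -> f 1%g = x ->
             exists p, shadowed_by psi eps f p].

Definition PSh S phi : set X :=
  [set x | forall eps, 0 < eps -> exists2 delta, 0 < delta &
     forall psi, action_dist S phi psi < delta ->
     forall f, pseudo_orbit S psi delta f -> f 1%g = x ->
       exists p, shadowed_by psi eps f p].

End Shadowing.

Section Measures.
Context (R : realType) (X : pmetricType R).

Definition borel_type := g_sigma_algebraType (@open X).

Definition integrals (mu : probability borel_type R) :
    prod_topology (fun _ : continuousType X R => R : topologicalType) :=
  fun f => \int[mu]_x f x.

(* The weak* topology: the coarsest one making mu |-> \int f dmu continuous for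
   every continuous f : X -> R.  Terms of type [probability] may differ on
   non-measurable sets; such terms are topologically indistinguishable here. *)
Definition borel_probability : topologicalType := initial_topology integrals.

Definition MPSh (G : groupType) (S : set G) (phi : continuous_action G X) :
    set borel_probability :=
  [set mu : probability borel_type R |
    forall eps : R, 0 < eps -> exists2 delta : R, 0 < delta &
    forall A : set borel_type, measurable A -> (0 < mu A)%E ->
    forall psi : continuous_action G X, action_dist S phi psi < delta ->
      A `&` Sh S psi delta eps !=set0].

End Measures.

(* Main.v *)
Require Import Defs.
From HB Require Import structures.
From mathcomp Require Import all_boot all_order all_algebra.
From mathcomp Require Import all_classical all_reals all_analysis.
From mathcomp Require Import finmap lra measurable_realfun.

Set Implicit Arguments.
Unset Strict Implicit.
Unset Printing Implicit Defensive.

Import Order.TTheory GRing.Theory Num.Theory.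
Import numFieldNormedType.Exports.

Local Open Scope classical_set_scope.
Local Open Scope ring_scope.

(** The proposition follows from a description of [MPSh] in terms of supports: a
    Borel probability measure belongs to [MPSh S phi] exactly when its support is
    contained in [PSh S phi] (lemma [MPSh_supp]).

    Granting this, both implications are soft.  The support of a Dirac mass is
    the singleton of its point, so [PSh S phi] is the preimage of [MPSh S phi]
    under the weak* continuous map sending a point to its Dirac mass, and it is
    closed when [MPSh S phi] is.  Conversely, for a closed set [C] the measures
    supported in [C] form a weak* closed set (lemma [closed_supp_sub]): if the
    support of a limit had a point [x] outside [C], a continuous bump around [x]
    vanishing on [C] would have integral zero for all the approximating measures
    but not for the limit.

    The description of [MPSh] rests on one perturbation argument,
    [Sh_perturb]: a pseudo orbit through [y] becomes a pseudo orbit through a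
    nearby point [x] when only its value at the identity is changed, at the cost
    of slightly worse constants.  It has two consequences.

    - The closure of [Sh S psi d e] lies in [Sh S psi (d - eta) (e + eta)].  If
      [mu] is in [MPSh S phi] and [x] in its support, every neighbourhood of [x]
      has positive mass, hence meets [Sh S psi d e] for every [psi] close to
      [phi], with the same [d]; so [x] is in a slightly larger shadowable set
      for all those [psi], that is, in [PSh S phi].

    - The constant [delta] given by [x] in [PSh S phi] also works, up to a
      factor, for all points near [x], because every action close to [phi]
      inherits the continuity of [phi] at [x] up to a small error.  Hence one
      [delta] serves a whole compact subset of [PSh S phi], such as the support
      of a measure; and a set of positive measure must meet the support, whose
      complement is null. *)

(** * Shadowable points under perturbation *)

Lemma near_finite_set (T : topologicalType) (I : choiceType) (D : set I)
    (P : I -> T -> Prop) (x : T) : finite_set D ->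
  (forall i, D i -> \forall y \near x, P i y) ->
  \forall y \near x, forall i, D i -> P i y.
Proof.
move=> finD nearP.
have : nbhs x (\bigcap_(i in [set` fset_set D]) P i).
  by apply: filter_bigI => i; rewrite in_fset_set// => /set_mem; exact: nearP.
by apply: filterS => y Py i Di; apply: Py; rewrite /= in_fset_set//; exact: mem_set.
Qed.

Section Persistence.
Context (R : realType) (G : groupType) (X : metricType R).
Implicit Types (S : set G) (phi psi : continuous_action G X).

Lemma near_mdist (x : X) (e : R) : 0 < e -> \forall y \near x, mdist x y < e.
Proof.
by move=> e0; have := nbhsx_ballx x e e0; rewrite ballEmdist.
Qed.

Lemma near_act phi (g : G) (x : X) (e : R) : 0 < e ->
  \forall y \near x, mdist (phi g x) (phi g y) < e.
Proof.
move=> e0; apply: metricType_numDomainType.cvgr_dist_lt => //.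
have gx : (g : discrete_topology G, y) @[y --> x] --> (g : discrete_topology G, x).
  by apply: (@cvg_pair X _ _ _ (nbhs (g : discrete_topology G)) (nbhs x)
    _ _ _ (cst (g : discrete_topology G)) id); [exact: cvg_cst|exact: cvg_id].
exact: (cvg_comp _ _ gx (@act_continuous _ _ phi (g, x))).
Qed.

Lemma compact_mdist_bounded (x0 : X) : compact [set: X] ->
  exists M : R, forall x, mdist x0 x <= M.
Proof.
move/compact_near_coveringP => /(_ R (pinfty_nbhs R)
  (fun M x => mdist x0 x <= M) _) h.
have : \forall M \near (pinfty_nbhs R), [set: X] `<=` (fun x => mdist x0 x <= M).
  apply: h => x _; near=> x' M => /=.
  apply: (le_trans (metric_triangle x0 x x')).
  apply: (@le_trans _ _ (mdist x0 x + 1)).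
    by rewrite lerD2l ltW//; near: x'; exact: near_mdist.
  by near: M; apply: nbhs_pinfty_ge; rewrite num_real.
move/filter_ex => [M hM]; exists M => x; exact: hM.
Unshelve. all: by end_near. Qed.

(** Compactness enters because [sup] is an upper bound only of bounded sets. *)
Lemma mdist_le_action_dist S phi psi s x : compact [set: X] -> S s ->
  mdist (phi s x) (psi s x) <= action_dist S phi psi.
Proof.
move=> /(compact_mdist_bounded x)[M hM] Ss.
apply: ub_le_sup; last by exists (s, x).
exists (M + M) => _ [[t y] _ <-] /=.
by rewrite (le_trans (metric_triangle _ x _))// lerD// metric_sym.
Qed.

Lemma Sh_mono S psi (d d' e e' : R) : d' <= d -> e <= e' ->
  Sh S psi d e `<=` Sh S psi d' e'.
Proof.
move=> dd ee x shx f fo f1; have [|p hp] := shx f _ f1.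
  by move=> s g Ss; exact: lt_le_trans (fo s g Ss) dd.
by exists p => g; exact: lt_le_trans (hp g) ee.
Qed.

(** Redefine the pseudo orbit [f] through [y] to take the value [x] at the
    identity.  The jump conditions involving that value are the one leaving the
    identity, which changes by the distance from [psi s x] to [psi s y], and the
    ones arriving there, which change by the distance from [x] to [y].  A point
    shadowing the new pseudo orbit shadows [f], with an additional error at the
    identity only. *)
Lemma Sh_perturb S psi (d e eta : R) (x y : X) : mdist x y < eta ->
  (forall s, S s -> mdist (psi s x) (psi s y) < eta) ->
  Sh S psi d e x -> Sh S psi (d - eta) (e + eta) y.
Proof.
move=> xy sxy shx f fo f1.
have eta0 : 0 < eta by exact: le_lt_trans (mdist_ge0 x y) xy.
pose f' g := if g == 1%g then x else f g.
have f'1 : f' 1%g = x by rewrite /f' eqxx.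
have [|p hp] := shx f' _ f'1.
  move=> s g Ss; rewrite /f'; have dlt := fo s g Ss.
  have [sg1|sg1] := eqVneq (s * g)%g 1%g; have [g1|g1] := eqVneq g 1%g.
  (* Only [s = 1] jumps from the identity to itself; the jump then has length
     zero, and [d] is positive because [f] satisfies some jump bound. *)
  - have s1 : s = 1%g by rewrite -sg1 g1 mulg1.
    have := mdist_ge0 (f (s * g)%g) (psi s (f g)).
    rewrite s1 !act1 mdistxx in dlt *; lra.
  - have := metric_triangle x y (psi s (f g)).
    rewrite sg1 f1 in dlt; lra.
  - have := metric_triangle (f (s * g)%g) (psi s y) (psi s x).
    rewrite g1 f1 in dlt; rewrite g1.
    have := sxy s Ss; rewrite [mdist (psi s x) _]metric_sym; lra.
  - lra.
exists p => g; have := hp g; rewrite /f'; case: eqVneq => [->|_] hg; last lra.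
have := metric_triangle y x (psi 1%g p).
rewrite f1 metric_sym in xy *; rewrite [mdist y x]metric_sym in xy *; lra.
Qed.

(** For a fixed action, [psi s x] and [psi s y] are close by continuity at [y].
    How close [x] must be taken depends on [psi], but the constants of the
    conclusion do not. *)
Lemma closure_Sh S psi (d e eta : R) : finite_set S -> 0 < eta ->
  closure (Sh S psi d e) `<=` Sh S psi (d - eta) (e + eta).
Proof.
move=> finS eta0 y cly.
have : \forall x \near y, mdist y x < eta /\
    forall s, S s -> mdist (psi s y) (psi s x) < eta.
  near=> x; split; first by near: x; exact: near_mdist.
  near: x; apply: near_finite_set => // s _.
  exact: near_act.
move=> /cly[x [shx [yx syx]]].
apply: Sh_perturb shx; first by rewrite metric_sym.
by move=> s Ss; rewrite metric_sym; exact: syx.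
Unshelve. all: by end_near. Qed.

(** Persistence at [x] spreads to a neighbourhood independent of [psi]: the
    distance from [psi s x] to [psi s y] is at most that from [phi s x] to
    [phi s y] plus twice the distance of the actions, and each of these three
    terms is kept below [eta / 3]. *)
Lemma PSh_near S phi (x : X) (e : R) :
  compact [set: X] -> finite_set S -> PSh S phi x -> 0 < e ->
  exists2 d, 0 < d & \forall y \near x, forall psi,
    action_dist S phi psi < d -> Sh S psi d e y.
Proof.
move=> cX finS px e0; have [d d0 hd] := px (e / 2) ltac:(lra).
pose eta := Num.min (d / 2) (e / 2).
have eta0 : 0 < eta by rewrite lt_min; apply/andP; split; lra.
have etad : eta <= d / 2 by rewrite ge_min lexx.
have etae : eta <= e / 2 by rewrite ge_min lexx orbT.
exists (eta / 3); first lra.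
near=> y => psi hpsi.
apply: (@Sh_mono _ _ (d - eta) _ (e / 2 + eta)); [lra|lra|].
apply: (@Sh_perturb _ _ _ _ _ x); last by apply: hd; lra.
  by near: y; exact: near_mdist.
move=> s Ss.
have hx := mdist_le_action_dist phi psi x cX Ss.
have hy := mdist_le_action_dist phi psi y cX Ss.
have t1 := metric_triangle (psi s x) (phi s x) (psi s y).
have t2 := metric_triangle (phi s x) (phi s y) (psi s y).
suff : mdist (phi s x) (phi s y) < eta / 3.
  by rewrite [mdist (psi s x) (phi s x)]metric_sym in t1; lra.
move: s Ss {hx hy t1 t2}; near: y; apply: near_finite_set => // s _.
by apply: near_act; lra.
Unshelve. all: by end_near. Qed.

(** The condition at each point only gets weaker as [d] decreases, so the local
    constants of [PSh_near] can be made uniform by compactness. *)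
Lemma PSh_compact_uniform S phi (K : set X) (e : R) :
  compact [set: X] -> finite_set S -> compact K -> K `<=` PSh S phi -> 0 < e ->
  exists2 d, 0 < d & forall x psi, K x -> action_dist S phi psi < d ->
    Sh S psi d e x.
Proof.
move=> cX finS /compact_near_coveringP cK KP e0.
have : \forall d \near 0^'+, K `<=` (fun x => forall psi,
    action_dist S phi psi < d -> Sh S psi d e x).
  apply: (cK _ (0^'+ : set_system R) (fun d x => forall psi,
    action_dist S phi psi < d -> Sh S psi d e x)) => x /KP px.
  have [d d0 hd] := PSh_near cX finS px e0.
  near=> y d' => /= psi hpsi.
  have d'd : d' <= d by near: d'; exact: nbhs_right_le.
  apply: (Sh_mono d'd (lexx e)).
  suff : forall psi, action_dist S phi psi < d -> Sh S psi d e y.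
    by apply; exact: lt_le_trans hpsi d'd.
  by near: y.
move=> h; near (0 : R)^'+ => d.
exists d; first by near: d; exact: nbhs_right_gt.
by move=> x psi Kx; move: x Kx psi; near: d.
Unshelve. all: by end_near. Qed.

End Persistence.

(** * The support of a Borel probability measure *)

Section Support.
Context (R : realType) (X : pmetricType R).
Implicit Types mu : probability (borel_type X) R.

Lemma open_borel (U : set X) : open U -> measurable (U : set (borel_type X)).
Proof. exact: sub_sigma_algebra. Qed.

Lemma continuous_borel (f : X -> R) : continuous f ->
  measurable_fun [set: borel_type X] (f : borel_type X -> R).
Proof.
move=> cf; apply: (measurability _ (RGenOInfty.measurableE R)).
move=> _ [_ [r ->] <-]; rewrite setTI; apply: open_borel.
by move/continuousP : cf; apply; exact: interval_open.
Qed.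

Definition supp mu : set X :=
  [set x | forall U : set X, open U -> U x -> (0 < mu U)%E].

Lemma notin_supp mu x : ~ supp mu x ->
  exists U : set X, [/\ open U, U x & mu U = 0%E].
Proof.
move=> /existsNP[U /not_implyP[oU /not_implyP[Ux /negP]]].
by rewrite -leNgt measure_le0 => /eqP; exists U.
Qed.

Lemma closed_supp mu : closed (supp mu).
Proof.
move=> x clx U oU Ux.
by have [y [sy /sy]] := clx U (open_nbhs_nbhs (conj oU Ux)); apply.
Qed.

Lemma negligible_compact mu (K : set X) : compact K -> K `<=` ~` supp mu ->
  mu.-negligible K.
Proof.
rewrite compact_cover => cK KN.
have [||D DU KD] := cK (set X) [set U | open U /\ mu U = 0%E] id.
- by move=> U [].
- by move=> x /KN /notin_supp[U [oU Ux U0]]; exists U.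
apply: (@negligibleS _ _ _ mu _ _ KD); rewrite /cover -bigsetU_fset_set// set_fsetK.
rewrite big_seq; elim/big_ind : _ => [|A B|U /DU /set_mem[oU U0]].
- exact: negligible_set0.
- exact: negligibleU.
- by apply/negligibleP => //; exact: open_borel.
Qed.

(** The complement of the support is a union of null open sets, possibly
    uncountable.  It is null because it is also the countable union of the
    compact sets [F n] of points at distance at least [1 / (n + 1)] from the
    support, and finitely many null open sets cover each [F n]. *)
Lemma measure_setC_supp mu : compact [set: X] -> mu (~` supp mu) = 0%E.
Proof.
move=> cX.
pose F n : set X := [set y | forall k, supp mu k -> n.+1%:R^-1 <= mdist k y].
have cF n : closed (F n).
  move=> y cly k sk; rewrite leNgt; apply/negP => lt_ky.
  have e0 : 0 < n.+1%:R^-1 - mdist k y by rewrite subr_gt0.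
  have [z [Fz yz]] := cly _ (near_mdist y e0).
  move: yz (Fz k sk) (metric_triangle k y z) => /=.
  by move: (n.+1%:R^-1) => r ? ? ?; lra.
have FN n : F n `<=` ~` supp mu.
  move=> y Fy /Fy; rewrite mdistxx leNgt => /negP; apply.
  by rewrite invr_gt0 ltr0n.
apply/negligibleP; first exact: open_borel (closed_openC (@closed_supp mu)).
apply: (@negligibleS _ _ _ mu (\bigcup_n F n)); last first.
  apply: negligible_bigcup => n; apply: negligible_compact (FN n).
  exact: subclosed_compact (cF n) cX _.
move=> y Ny.
have : nbhs y (~` supp mu).
  by apply: open_nbhs_nbhs; split => //; exact: closed_openC (@closed_supp mu).
rewrite -metricType_numDomainType.nbhs_nbhs_mdist => -[e /= e0 ye].
have [n ne] : exists n, n.+1%:R^-1 < e.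
  have [n _] := near_infty_natSinv_lt (PosNum e0).
  by move=> /(_ n (leqnn n)) /= ?; exists n.
exists n => // k sk; rewrite leNgt; apply/negP => kn.
by apply: ye sk => /=; rewrite metric_sym (lt_trans kn).
Qed.

Lemma mdist_continuous (x : X) : continuous (mdist x : X -> R).
Proof.
move=> y; apply/cvgrPdist_lt => e e0; near=> z.
have yz : mdist y z < e by near: z; exact: near_mdist.
have := metric_triangle x y z; have := metric_triangle x z y.
rewrite [mdist z y]metric_sym ltr_norml; lra.
Unshelve. all: by end_near. Qed.

End Support.

(** * Supports and the weak* topology *)

Section WeakStar.
Context (R : realType) (X : pmetricType R).
Implicit Types mu : probability (borel_type X) R.

(** This turns a statement about supports into the vanishing of a weak*
    continuous function of the measure. *)
Lemma Rintegral_eq0_supp mu (h : X -> R) : compact [set: X] -> continuous h ->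
  (forall x, 0 <= h x) ->
  \int[mu]_x h x = 0 <-> supp mu `<=` [set x | h x = 0].
Proof.
move=> cX ch h0.
have mh := continuous_borel ch.
have oh : open [set x | h x != 0].
  by move/continuousP : ch => /(_ [set r | r != 0]); apply; exact: open_neq.
have ih : mu.-integrable [set: borel_type X] (EFin \o h).
  apply: measurable_bounded_integrable => //.
    exact: le_lt_trans (probability_le1 mu measurableT) (ltry 1).
  have /compact_bounded : compact ((h : X -> R^o) @` [set: X]).
    apply: (@continuous_compact X R^o h [set: X]) => //.
    exact: (@continuous_subspaceT X R^o [set: X] h ch).
  move=> [M [rM hM]]; exists M; split=> // r Mr x _.
  by apply: (hM r Mr); exists x.
(* The real-valued integral is the finite part of the extended one, and would
   also vanish on an infinite integral: integrability is what rules this out. *)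
have -> : \int[mu]_x h x = 0 <-> (\int[mu]_x `|(h x)%:E| = 0)%E.
  have -> : (\int[mu]_x `|(h x)%:E| = \int[mu]_x (h x)%:E)%E.
    by apply: eq_integral => x _; rewrite /= ger0_norm.
  rewrite /Rintegral; split=> [|->//].
  have fin := integrable_fin_num measurableT ih.
  by move=> int0; rewrite -(fineK fin) int0.
have -> : (\int[mu]_x `|(h x)%:E| = 0)%E <-> mu [set x | h x != 0] = 0%E.
  rewrite (ae_eq_integral_abs mu measurableT); last exact/measurable_EFinP.
  rewrite -(negligibleP mu (open_borel oh)).
  have -> : [set x : borel_type X | h x != 0] =
    ~` [set x : borel_type X | setT x -> (h x)%:E = cst 0%E x].
    apply/seteqP; split => x /=.
      by move=> /eqP hx /(_ I) [].
    by move=> hx; apply/eqP => hx0; apply: hx => _; rewrite hx0.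
  by [].
split=> [mh0 x sx|sh].
  apply: contrapT => /eqP hx.
  by have := sx _ oh hx; rewrite mh0 ltxx.
apply/(negligibleP mu (open_borel oh)).
apply: (@negligibleS _ _ _ mu (~` supp mu)).
  by move=> x /eqP hx /sh.
apply/negligibleP; last exact: measure_setC_supp.
exact: open_borel (closed_openC (@closed_supp _ _ mu)).
Qed.

Lemma integrals_continuous (f : continuousType X R) :
  continuous (fun mu : borel_probability X => integrals mu f).
Proof.
move=> mu; apply: (@continuous_comp _ _ _ (@integrals R X : borel_probability X -> _)
  (@proj _ (fun _ => R : topologicalType) f)).
  exact: initial_continuous.
exact: proj_continuous.
Qed.

Lemma closed_supp_sub (C : set X) : compact [set: X] -> closed C ->
  closed [set mu : borel_probability X | supp mu `<=` C].
Proof.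
move=> cX cC mu clmu x sx; apply: contrapT => nCx.
have : nbhs x (~` C) by apply: open_nbhs_nbhs; split => //; exact: closed_openC.
rewrite -metricType_numDomainType.nbhs_nbhs_mdist => -[e /= e0 xe].
pose h := (fun y => (0 : R^o)) \max (fun y => e - mdist x y : R^o).
have ch : continuous (h : X -> R).
  move=> y; apply: continuous_max; first exact: cvg_cst.
  by apply: cvgB; [exact: cvg_cst|exact: mdist_continuous].
have h0 y : 0 <= h y by rewrite /h le_max lexx.
have hC : C `<=` [set y | h y = 0].
  move=> y Cy; apply/max_idPl; rewrite subr_le0 leNgt; apply/negP => xy.
  exact: xe Cy.
have : closed [set nu : borel_probability X | integrals nu (mkcts ch) = 0].
  have /continuous_closedP := @integrals_continuous (mkcts ch).
  by move=> /(_ [set r | r = 0]); apply; exact: closed_eq.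
move=> /(_ mu); have /[swap] /[apply] : closure
  [set nu : borel_probability X | integrals nu (mkcts ch) = 0] mu.
  apply: closureS clmu => nu snu.
  by apply/(Rintegral_eq0_supp nu cX ch h0); exact: subset_trans hC.
move/(Rintegral_eq0_supp mu cX ch h0) => /(_ _ sx).
by move=> /max_idPl; rewrite mdistxx subr0 leNgt e0.
Qed.

(** The ascription selects the weak* topology on the type of measures. *)
Definition dirac_probability (x : X) : borel_probability X :=
  (\d_(x : borel_type X) : probability (borel_type X) R).

Lemma dirac_probability_continuous : continuous dirac_probability.
Proof.
apply: continuous_comp_initial => x; apply/cvg_sup => f.
apply: (@continuous_comp_initial _ _ _ (fun g : continuousType X R -> R => g f)
  (@integrals R X \o dirac_probability)) => {}x.
rewrite (_ : _ \o _ = f); last first.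
  apply/funext => y /=; rewrite /integrals /Rintegral integral_dirac//.
    by rewrite diracT mul1e.
  apply/measurable_EFinP; apply: continuous_borel; exact: cts_fun.
exact: cts_fun.
Qed.

Lemma supp_dirac (x : X) : supp (dirac_probability x) = [set x].
Proof.
apply/seteqP; split => [y sy|_ -> U _ Ux].
  apply: contrapT => yx.
  have oU : open (~` [set x]).
    apply: closed_openC; apply: accessible_closed_set1.
    exact: hausdorff_accessible (@metric_hausdorff _ _).
  by have := sy _ oU yx; rewrite /= diracE memNset ?ltxx//; apply.
by rewrite /= diracE mem_set// lte01.
Qed.

End WeakStar.

(** * Persistently shadowable measures *)

(** From left to right, the open neighbourhoods of a point of the support are
    used as test sets.  From right to left, the support is compact, which gives
    one [d] for all its points, and no set of positive measure misses it. *)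
Lemma MPSh_supp (R : realType) (G : groupType) (S : set G) (X : pmetricType R)
    (phi : continuous_action G X) (mu : probability (borel_type X) R) :
  finite_set S -> compact [set: X] ->
  MPSh S phi mu <-> supp mu `<=` PSh S phi.
Proof.
move=> finS cX; split => [Mmu x sx|sP] e e0.
  have [d d0 hd] := Mmu (e / 2) ltac:(lra).
  (* Moving to a limit point costs [eta] in both constants, and [eta] is small
     enough to end with [d / 2] and [e]. *)
  pose eta := Num.min (d / 2) (e / 2).
  have eta0 : 0 < eta by rewrite lt_min; apply/andP; split; lra.
  have etad : eta <= d / 2 by rewrite ge_min lexx.
  have etae : eta <= e / 2 by rewrite ge_min lexx orbT.
  exists (d / 2) => [|psi hpsi]; first lra.
  suff : Sh S psi (d / 2) e x by [].
  apply: (@Sh_mono _ _ _ _ _ (d - eta) _ (e / 2 + eta)); [lra|lra|].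
  apply: closure_Sh => // B; rewrite nbhsE => -[U [oU Ux] UB].
  have [|y [Uy shy]] := hd U (open_borel oU) (sx U oU Ux) psi; first lra.
  by exists y; split => //; exact: UB.
have csupp : compact (supp mu).
  exact: subclosed_compact (@closed_supp _ _ mu) cX _.
have [d d0 hd] := PSh_compact_uniform cX finS csupp sP e0.
exists d => // A mA A0 psi hpsi.
have [x [Ax sx]] : A `&` supp mu !=set0.
  apply/set0P/negP => /eqP /disjoints_subset AN.
  have : (mu A <= mu (~` supp mu))%E.
    apply: le_measure => //; apply: mem_set => //.
    exact: open_borel (closed_openC (@closed_supp _ _ mu)).
  by rewrite measure_setC_supp// leNgt A0.
by exists x; split => //; exact: hd.
Qed.

Theorem proposition3p12 (R : realType) (G : groupType) (S : set G)
    (S_finite : finite_set S) (S_generates : generates S)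
    (X : pmetricType R) (X_compact : compact [set: X])
    (phi : continuous_action G X) :
  closure (MPSh S phi) = MPSh S phi <-> closure (PSh S phi) = PSh S phi.
Proof.
have MPShE : MPSh S phi = [set mu : borel_probability X | supp mu `<=` PSh S phi].
  by apply/seteqP; split => mu /(MPSh_supp _ _ S_finite X_compact).
have PShE : PSh S phi = @dirac_probability R X @^-1` MPSh S phi.
  rewrite MPShE; apply/seteqP; split => x /=; rewrite supp_dirac.
    by move=> px _ ->.
  by apply.
split=> /esym/closure_id cl; apply/esym/closure_id.
  rewrite PShE.
  by have /continuous_closedP := @dirac_probability_continuous R X; exact.
by rewrite MPShE; exact: closed_supp_sub.
Qed.
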